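(* For each integer $r \geq 1$, let $G_r$ be the graph of order $3r+4$ that is the join of the complete graph $K_{r+2}$ with the disjoint union of $r+1$ copies of $K_2$. Then $G_r$ and the complete graph $K_{3r+4}$ are equienergetic, i.e. $E(G_r) = E(K_{3r+4})$.
   Context: The energy of a graph $G$ with adjacency eigenvalues $\lambda_1,\ldots,\lambda_n$ (with multiplicity) is $E(G)=\sum_{i=1}^n|\lambda_i|$. Two graphs $G$ and $H$ are equienergetic if $E(G)=E(H)$. The join of two vertex-disjoint graphs is obtained from their disjoint union by adding all edges between them. *)

(* Defs.v *)
From HB Require Import structures.
From mathcomp Require Import all_boot all_order all_algebra.
From mathcomp Require Import zify.

Set Implicit Arguments.
Unset Strict Implicit.
Unset Printing Implicit Defensive.

Import Order.TTheory GRing.Theory Num.Theory.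

Local Open Scope ring_scope.

Record sgraph := SGraph {
  vertex :> finType;
  adj : rel vertex;
  adj_sym : symmetric adj;
  adj_irrefl : irreflexive adj
}.

Lemma complete_sym n : symmetric (fun i j : 'I_n => i != j).
Proof. by move=> i j; rewrite eq_sym. Qed.

Lemma complete_irrefl n : irreflexive (fun i j : 'I_n => i != j).
Proof. by move=> i; rewrite eqxx. Qed.

Definition complete_graph (n : nat) : sgraph :=
  SGraph (@complete_sym n) (@complete_irrefl n).

(* In the disjoint union of m copies of G, the pair (i, x) is the vertex x of
   the i-th copy. *)
Definition copies_adj (m : nat) (G : sgraph) : rel ('I_m * G)%type :=
  fun u v => (u.1 == v.1) && adj u.2 v.2.

Lemma copies_sym m G : symmetric (@copies_adj m G).
Proof. by move=> u v; rewrite /copies_adj eq_sym adj_sym. Qed.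

Lemma copies_irrefl m G : irreflexive (@copies_adj m G).
Proof. by move=> u; rewrite /copies_adj adj_irrefl andbF. Qed.

Definition copies (m : nat) (G : sgraph) : sgraph :=
  SGraph (@copies_sym m G) (@copies_irrefl m G).

Definition join_adj (G H : sgraph) : rel (G + H)%type :=
  fun u v =>
    match u, v with
    | inl x, inl y => adj x y
    | inr x, inr y => adj x y
    | _, _ => true
    end.

Lemma join_sym G H : symmetric (@join_adj G H).
Proof. by case=> x [] y //=; rewrite adj_sym. Qed.

Lemma join_irrefl G H : irreflexive (@join_adj G H).
Proof. by case=> x /=; rewrite adj_irrefl. Qed.

Definition join_graph (G H : sgraph) : sgraph :=
  SGraph (@join_sym G H) (@join_irrefl G H).

Definition adjacency_matrix (C : numClosedFieldType) (G : sgraph) : 'M[C]_#|G| :=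
  \matrix_(i, j) (adj (enum_val i) (enum_val j))%:R.

(* The eigenvalues of A listed with algebraic multiplicity, in an unspecified
   order. *)
Definition eigenvalues (C : numClosedFieldType) (n : nat) (A : 'M[C]_n) : seq C :=
  sval (closed_field_poly_normal (char_poly A)).

Lemma char_poly_eigenvalues (C : numClosedFieldType) (n : nat) (A : 'M[C]_n) :
  char_poly A = \prod_(z <- eigenvalues A) ('X - z%:P).
Proof.
rewrite /eigenvalues; case: closed_field_poly_normal => s /= {1}->.
by rewrite (monicP (char_poly_monic A)) scale1r.
Qed.

(* C stands for the complex numbers; instances are algC and R[i] for any real
   closed field R. The adjacency matrix is real symmetric, so its eigenvalues are real and the
   modulus of C is the usual absolute value on them. *)
Definition energy (C : numClosedFieldType) (G : sgraph) : C :=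
  \sum_(z <- eigenvalues (adjacency_matrix C G)) `|z|.

Definition equienergetic (C : numClosedFieldType) (G H : sgraph) : Prop :=
  energy C G = energy C H.

Definition join_family (r : nat) : sgraph :=
  join_graph (complete_graph (r + 2)) (copies (r + 1) (complete_graph 2)).

Lemma card_join_family (r : nat) : #|join_family r| = (3 * r + 4)%N.
Proof. rewrite card_sum card_prod !card_ord; lia. Qed.

(* Main.v *)
Require Import Defs.
From HB Require Import structures.
From mathcomp Require Import all_boot all_order all_algebra.
From mathcomp Require Import ring.

Set Implicit Arguments.
Unset Strict Implicit.
Unset Printing Implicit Defensive.

Import Order.TTheory GRing.Theory Num.Theory.

(** Both energies equal 6r+6.  The idea is to read the energy as the trace of
the matrix |A| and to avoid any computation of multiplicities: the adjacency
matrix A is real symmetric, hence unitarily diagonalizable, so that f(A) makes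
sense for every function f, the map f |-> f(A) is multiplicative and additive,
and tr f(A) is the sum of f over the spectrum ([mxtrace_mxfun]).  If f agrees
with the absolute value on the spectrum, the energy is tr f(A)
([energy_trace]).  A polynomial f of low degree can be used as soon as a
polynomial annihilating A, which confines the spectrum ([mxfun_eq0]), is known.

For the complete graph on n vertices, A + 1 is the all-ones matrix, with square
n (A + 1); the eigenvalues are thus among -1 and n - 1, an affine f suffices,
and the energy is 2 (n - 1) ([energy_complete]).

For the join of K_a with m copies of K_2, any two vertices of K_a, and the two
vertices of each K_2, are twins: A + 1 has only entries 0 and 1, and its entry
is 0 exactly at pairs lying in different copies of K_2.  It follows that
A^2 - 1 = (A + 1)^2 - 2 (A + 1) is constant on each of the four blocks cut out
by the two sides of the join ([twinM]), and that right multiplication by A + 1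
acts on such matrices through their four values ([block_constM]).  A short
calculation gives
  (A^2 - 1) (A^2 - a A + a - 1 - 2 a m) = 0,
where the quadratic factor is the characteristic polynomial of the quotient of
the graph by the two sides of the join ([join_eigenvalues]).

When a = r + 2 and m = r + 1 the quadratic factor splits as
(z - (2r + 3)) (z + (r + 1)), so the spectrum lies in
{-1, 1, 2r + 3, -(r + 1)}.  On these four points the absolute value is a cubic
polynomial ([abs_join_family]), whose trace at A is obtained from the traces of
two block-constant matrices ([energy_join]). *)

Local Open Scope ring_scope.

(** * Functions of a normal matrix *)

(** The functional calculus: f acts on the eigenvalues in a unitary
eigenbasis.  Arbitrary functions rather than polynomials are allowed so that
matrices of every size, zero included, are covered. *)
Definition mxfun (C : numClosedFieldType) n (f : C -> C) (A : 'M[C]_n) : 'M[C]_n :=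
  invmx (spectralmx A) *m diag_mx (map_mx f (spectral_diag A)) *m spectralmx A.

Section FunctionalCalculus.

Variables (C : numClosedFieldType) (n : nat) (A : 'M[C]_n).
Implicit Types f g : C -> C.

Lemma mxfunM f g : mxfun f A *m mxfun g A = mxfun (fun z => f z * g z) A.
Proof.
rewrite /mxfun !mulmxA mulmxK ?spectral_unit // -!mulmxA; congr (_ *m _).
rewrite !mulmxA; congr (_ *m _); rewrite mulmx_diag; congr diag_mx.
by apply/rowP=> i; rewrite !mxE.
Qed.

Lemma mxfunD f g : mxfun f A + mxfun g A = mxfun (fun z => f z + g z) A.
Proof.
rewrite /mxfun -mulmxDl -mulmxDr -raddfD; congr (_ *m diag_mx _ *m _).
by apply/rowP=> i; rewrite !mxE.
Qed.

Lemma mxfun_cst c : mxfun (fun=> c) A = c%:M.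
Proof.
rewrite /mxfun (_ : map_mx _ _ = const_mx c).
  by rewrite diag_const_mx scalar_mxC -mulmxA mulVmx ?spectral_unit ?mulmx1.
by apply/rowP=> i; rewrite !mxE.
Qed.

Lemma mxfunZ c f : c *: mxfun f A = mxfun (fun z => c * f z) A.
Proof. by rewrite -mul_scalar_mx -mxfun_cst mxfunM. Qed.

Lemma mxfun_id : A \is normalmx -> mxfun id A = A.
Proof. by move/orthomx_spectralP=> {2}->; rewrite /mxfun map_mx_id. Qed.

(** Similar matrices have the same characteristic polynomial, and a product of
monic linear factors determines the multiset of its roots. *)
Lemma perm_eigenvalues : A \is normalmx ->
  perm_eq (eigenvalues A) [seq spectral_diag A 0 i | i <- enum 'I_n].
Proof.
move=> nA; apply: prod_XsubC_eq; rewrite -char_poly_eigenvalues big_map big_enum /=.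
pose P := map_mx polyC (spectralmx A); pose Q := map_mx polyC (invmx (spectralmx A)).
have QP : Q *m P = 1%:M by rewrite -map_mxM mulVmx ?spectral_unit // map_mx1.
have -> : char_poly A = char_poly (diag_mx (spectral_diag A)).
  rewrite /char_poly /char_poly_mx {1}(orthomx_spectralP nA) !map_mxM -/P -/Q.
  have XE : 'X%:M = Q *m 'X%:M *m P :> 'M[{poly C}]_n.
    by rewrite scalar_mxC -mulmxA QP mulmx1.
  rewrite [in LHS]XE {XE}.
  rewrite -mulmxBl -mulmxBr !det_mulmx mulrC mulrA -det_mulmx.
  by rewrite (mulmx1C QP) det1 mul1r.
rewrite char_poly_trig ?diag_mx_is_trig //.
by apply: eq_bigr => i _; rewrite mxE eqxx.
Qed.

Lemma mxtrace_mxfun f : A \is normalmx ->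
  \tr (mxfun f A) = \sum_(z <- eigenvalues A) f z.
Proof.
move=> nA; rewrite (perm_big _ (perm_eigenvalues nA)) big_map big_enum /=.
rewrite /mxfun mxtrace_mulC mulmxA mulmxV ?spectral_unit // mul1mx mxtrace_diag.
by apply: eq_bigr => i _; rewrite mxE.
Qed.

(** In the eigenbasis, f(A) = 0 says that f kills every diagonal entry. *)
Lemma mxfun_eq0 f : A \is normalmx -> mxfun f A = 0 ->
  {in eigenvalues A, forall z, f z = 0}.
Proof.
move=> nA fA0 z; rewrite (perm_mem (perm_eigenvalues nA)) => /mapP[i _ ->].
have : spectralmx A *m mxfun f A *m invmx (spectralmx A) = 0.
  by rewrite fA0 mulmx0 mul0mx.
rewrite /mxfun !mulmxA mulmxV ?spectral_unit // mul1mx.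
rewrite mulmxK ?spectral_unit // => /matrixP/(_ i i).
by rewrite !mxE eqxx.
Qed.

End FunctionalCalculus.

(** * Energy as a trace *)

Lemma adjacency_normal (C : numClosedFieldType) (G : sgraph) :
  adjacency_matrix C G \is normalmx.
Proof.
apply: hermitian_normalmx; apply/is_hermitianmxP/matrixP=> i j.
by rewrite !mxE expr0 mul1r adj_sym conjC_nat.
Qed.

(** The energy is the trace of |A|, and f(A) = |A| when f interpolates the
absolute value on the spectrum. *)
Lemma energy_trace (C : numClosedFieldType) (G : sgraph) (f : C -> C) :
  {in eigenvalues (adjacency_matrix C G), forall z, `|z| = f z} ->
  energy C G = \tr (mxfun f (adjacency_matrix C G)).
Proof.
move=> absf; rewrite mxtrace_mxfun ?adjacency_normal //.
exact: eq_big_seq.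
Qed.

(** * Matrices indexed by vertices *)

(** Kernels on vertices, transported to ordinals by the same enumeration as the
adjacency matrix, so that products and traces become sums over vertices. *)
Definition vertex_mx (C : numClosedFieldType) (G : sgraph) (k : G -> G -> C)
    : 'M[C]_#|G| :=
  \matrix_(i, j) k (enum_val i) (enum_val j).

Section VertexMatrix.

Variables (C : numClosedFieldType) (G : sgraph).
Implicit Types k l : G -> G -> C.

Lemma eq_vertex_mx k l : k =2 l -> vertex_mx k = vertex_mx l.
Proof. by move=> kl; apply/matrixP=> i j; rewrite !mxE kl. Qed.

Lemma vertex_mxM k l :
  vertex_mx k *m vertex_mx l = vertex_mx (fun x y => \sum_z k x z * l z y).
Proof.
apply/matrixP=> i j; rewrite !mxE [RHS](big_enum_val (A := predT)) /=.
by apply: eq_bigr => h _; rewrite !mxE.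
Qed.

Lemma mxtrace_vertex_mx k : \tr (vertex_mx k) = \sum_x k x x.
Proof.
rewrite [RHS](big_enum_val (A := predT)) /=.
by apply: eq_bigr => i _; rewrite mxE.
Qed.

Lemma vertex_mxD k l :
  vertex_mx k + vertex_mx l = vertex_mx (fun x y => k x y + l x y).
Proof. by apply/matrixP=> i j; rewrite !mxE. Qed.

Lemma vertex_mxZ c k : c *: vertex_mx k = vertex_mx (fun x y => c * k x y).
Proof. by apply/matrixP=> i j; rewrite !mxE. Qed.

(** Adding the identity turns adjacency into closed adjacency, for which twins
have equal rows; computations with A + 1 are simpler than with A. *)
Lemma adjacencyD1 :
  adjacency_matrix C G + 1%:M = vertex_mx (fun x y => (adj x y || (x == y))%:R).
Proof.
apply/matrixP=> i j; rewrite !mxE (inj_eq enum_val_inj).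
by case: eqP => [->|_]; rewrite ?adj_irrefl ?add0r // orbF addr0.
Qed.

Lemma mxfunD1 :
  mxfun (fun z => z + 1) (adjacency_matrix C G) = adjacency_matrix C G + 1%:M.
Proof.
by rewrite -(mxfunD _ id) mxfun_cst mxfun_id ?adjacency_normal.
Qed.

End VertexMatrix.

(** * Complete graphs *)

(** The all-ones matrix A + 1 squares to (n + 1) (A + 1), so z + 1 is 0 or
n + 1 for each eigenvalue z; the affine function below takes the values 1 and
n at the corresponding z. *)
Lemma energy_complete (C : numClosedFieldType) n :
  energy C (complete_graph n.+1) = 2 * n%:R.
Proof.
pose A := adjacency_matrix C (complete_graph n.+1).
have BE : mxfun (fun z => z + 1) A = vertex_mx (fun x y => 1).
  by rewrite mxfunD1 adjacencyD1; apply: eq_vertex_mx => i j /=; rewrite orNb.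
have n0 : n.+1%:R != 0 :> C by rewrite pnatr_eq0.
have roots : mxfun (fun z => (z + 1) * (z + 1) + - n.+1%:R * (z + 1)) A = 0.
  rewrite -mxfunD -mxfunM -mxfunZ BE vertex_mxM vertex_mxZ vertex_mxD.
  apply/matrixP=> i j; rewrite !mxE sumr_const card_ord mulr1 addrC.
  by rewrite mulr1 addNr.
rewrite (@energy_trace _ _ (fun z => 1 + (n.+1%:R - 2) / n.+1%:R * (z + 1))).
  rewrite -mxfunD mxfun_cst -mxfunZ BE mxtraceD mxtraceZ mxtrace_scalar.
  rewrite mxtrace_vertex_mx sumr_const card_ord.
  rewrite -[n.+1]addn1 natrD in n0 *.
  by field.
move=> z /(mxfun_eq0 (adjacency_normal C _) roots)/eqP.
rewrite -mulrDl mulf_eq0 addr_eq0 opprK addr_eq0 => /orP[]/eqP z1.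
  have -> : z = n%:R by apply: (addIr 1); rewrite z1 -natr1.
  by rewrite normr_nat -natr1 in n0 *; field.
by rewrite z1 addNr mulr0 addr0 normrN1.
Qed.

(** * Joins of a complete graph with copies of K_2 *)

Section Join.

Variables (C : numClosedFieldType) (a m : nat).

Local Notation G := (join_graph (complete_graph a) (copies m (complete_graph 2))).
Local Notation A := (adjacency_matrix C G).

Definition block_const (p q p' q' : C) (x y : G) : C :=
  match x, y with
  | inl _, inl _ => p
  | inl _, inr _ => q
  | inr _, inl _ => p'
  | inr _, inr _ => q'
  end.

Definition twin (x y : G) : C :=
  if (x, y) is (inr u, inr v) then (u.1 == v.1)%:R else 1.

Lemma mxfunD1_join : mxfun (fun z => z + 1) A = vertex_mx twin.
Proof.
rewrite mxfunD1 adjacencyD1; apply: eq_vertex_mx => -[i|[i s]] [j|[j t]] //=.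
  by rewrite -[inl _ == inl _]/(i == j) orNb.
rewrite /copies_adj /= -[inr _ == inr _]/((i == j) && (s == t)).
by rewrite -andb_orr orNb andbT.
Qed.

(** Functions that do not separate the two vertices of a copy of K_2 are
the only ones to be summed. *)
Lemma sum_join (f : G -> C) (c : C) (g : 'I_m -> C) :
    (forall i, f (inl i) = c) -> (forall u, f (inr u) = g u.1) ->
  \sum_x f x = a%:R * c + 2 * \sum_i g i.
Proof.
move=> fl fr; rewrite big_sumType /=; congr (_ + _).
  by rewrite (eq_bigr _ (fun i _ => fl i)) sumr_const card_ord mulr_natl.
rewrite (eq_bigr _ (fun u _ => fr u)).
rewrite -(pair_bigA _ (fun i (_ : 'I_2) => g i)) /= mulr_sumr.
by apply: eq_bigr => i _; rewrite sumr_const card_ord mulr_natl.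
Qed.

Lemma sum_delta (F : 'I_m -> C) (i : 'I_m) : \sum_j F j * (j == i)%:R = F i.
Proof.
by rewrite (bigD1 i) //= eqxx mulr1 big1 ?addr0 // => j /negPf->; rewrite mulr0.
Qed.

(** A vertex of K_a is a closed neighbour of all vertices; a vertex in a copy of K_2
is a closed neighbour of K_a and of its own copy. *)
Lemma block_constM p q p' q' :
  vertex_mx (block_const p q p' q') *m vertex_mx twin =
  vertex_mx (block_const (a%:R * p + 2 * m%:R * q) (a%:R * p + 2 * q)
                         (a%:R * p' + 2 * m%:R * q') (a%:R * p' + 2 * q')).
Proof.
rewrite vertex_mxM; apply: eq_vertex_mx => -[i|u] [j|v] /=.
- rewrite (@sum_join _ p (fun=> q)) => [|k|w] /=; rewrite ?mulr1 //.
  by rewrite sumr_const card_ord -mulrA !mulr_natl.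
- rewrite (@sum_join _ p (fun k => q * (k == v.1)%:R)) => [|k|w] /=; rewrite ?mulr1 //.
  by rewrite sum_delta.
- rewrite (@sum_join _ p' (fun=> q')) => [|k|w] /=; rewrite ?mulr1 //.
  by rewrite sumr_const card_ord -mulrA !mulr_natl.
- rewrite (@sum_join _ p' (fun k => q' * (k == v.1)%:R)) => [|k|w] /=; rewrite ?mulr1 //.
  by rewrite sum_delta.
Qed.

(** On pairs within the copies of K_2, the square of A + 1 is a plus twice the
indicator of lying in the same copy; subtracting 2 (A + 1) cancels the latter,
which is why the result is block-constant. *)
Lemma twinM :
  vertex_mx twin *m vertex_mx twin + - 2 *: vertex_mx twin =
  vertex_mx (block_const (a%:R + 2 * m%:R - 2) a%:R a%:R a%:R).
Proof.
rewrite vertex_mxM vertex_mxZ vertex_mxD; apply: eq_vertex_mx => -[i|u] [j|v] /=.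
- rewrite (@sum_join _ 1 (fun=> 1)) => [|k|w] /=; rewrite ?mulr1 //.
  by rewrite sumr_const card_ord.
- rewrite (@sum_join _ 1 (fun k => 1 * (k == v.1)%:R)) => [|k|w] /=; rewrite ?mulr1 //.
  by rewrite sum_delta; ring.
- rewrite (@sum_join _ 1 (fun k => 1 * (k == u.1)%:R)) => [|k|w] /=.
  + by rewrite sum_delta /twin; ring.
  + by rewrite mulr1.
  + by rewrite mulr1 mul1r eq_sym.
- rewrite (@sum_join _ 1 (fun k => (u.1 == k)%:R * (k == v.1)%:R)) => [|k|w] /=.
  + by rewrite sum_delta /twin; ring.
  + by rewrite mulr1.
  + by [].
Qed.

Lemma mxtrace_block_const p q p' q' :
  \tr (vertex_mx (block_const p q p' q')) = a%:R * p + 2 * m%:R * q'.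
Proof.
rewrite mxtrace_vertex_mx (@sum_join _ p (fun=> q')) //.
by rewrite sumr_const card_ord -mulrA !mulr_natl.
Qed.

(* This is z^2 - 1, written in terms of z + 1. *)
Let nn (z : C) := (z + 1) * (z + 1) + - 2 * (z + 1).

Lemma mxfun_block :
  mxfun nn A = vertex_mx (block_const (a%:R + 2 * m%:R - 2) a%:R a%:R a%:R).
Proof. by rewrite -mxfunD -mxfunM -mxfunZ mxfunD1_join twinM. Qed.

(** The factor z^2 - 1 accounts for the eigenvectors with zero sum on K_a and on
the union of the copies of K_2, the quadratic factor for those that are constant
on each of these two sets. *)
Lemma join_eigenvalues z : z \in eigenvalues A ->
  (z ^+ 2 - 1) * (z ^+ 2 - a%:R * z + a%:R - 1 - 2 * a%:R * m%:R) = 0.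
Proof.
(* The same polynomial, with the quadratic factor expanded in powers of
   z + 1, so that its value at A is a combination of block-constant matrices. *)
have roots : mxfun (fun z => nn z * (z + 1) * (z + 1)
    + (- (a%:R + 2) * (nn z * (z + 1)) + 2 * a%:R * (1 - m%:R) * nn z)) A = 0.
  rewrite -mxfunD -[X in _ + X]mxfunD -!mxfunZ -!mxfunM mxfun_block mxfunD1_join.
  rewrite !block_constM !vertex_mxZ !vertex_mxD.
  apply/matrixP=> i j; rewrite !mxE /block_const.
  by case: (enum_val i) => ?; case: (enum_val j) => ?; ring.
move/(mxfun_eq0 (adjacency_normal C _) roots) => <-.
rewrite /nn; ring.
Qed.

(** Any cubic that takes the value 1 at 1 and at -1 has this form; the traces of A^2 - 1
and of (A^2 - 1) A then give the energy. *)
Lemma energy_join (u v : C) :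
    {in eigenvalues A, forall z, `|z| = 1 + (z ^+ 2 - 1) * (u + v * z)} ->
  energy C G = a%:R + 2 * m%:R + u * (a%:R * (a%:R + 4 * m%:R - 2))
    + v * (a%:R * ((a%:R - 1) * (a%:R + 4 * m%:R - 2) + 2 * m%:R * (a%:R + 2))).
Proof.
move=> absE.
rewrite (@energy_trace _ _
  (fun z => 1 + ((u - v) * nn z + v * (nn z * (z + 1))))).
  rewrite -mxfunD -[X in _ + X]mxfunD mxfun_cst -!mxfunZ -mxfunM.
  rewrite mxfun_block mxfunD1_join block_constM !mxtraceD !mxtraceZ.
  rewrite mxtrace_scalar !mxtrace_block_const card_sum card_prod !card_ord.
  by rewrite natrD natrM; ring.
by move=> z /absE->; rewrite /nn; ring.
Qed.

End Join.

(** The linear factor (5r + 7 - z) / c is the interpolant of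
(|z| - 1) / (z^2 - 1), whose values are 1 / (2r + 4) at 2r + 3 and
1 / (r + 2) at -(r + 1) when r > 0. *)
Lemma abs_join_family (C : numClosedFieldType) r
    (c := 2 * (r%:R + 2) * (3 * r%:R + 4) : C) :
  {in eigenvalues (adjacency_matrix C (join_family r)),
    forall z, `|z| = 1 + (z ^+ 2 - 1) * ((5 * r%:R + 7) / c + - c^-1 * z)}.
Proof.
have r20 : r%:R + 2 != 0 :> C by rewrite -natrD pnatr_eq0 addn2.
have r40 : 3 * r%:R + 4 != 0 :> C by rewrite -natrM -natrD pnatr_eq0 addn4.
move=> z /join_eigenvalues; rewrite !natrD => zE.
have {zE} : (z - 1) * (z + 1) * ((z - (2 * r%:R + 3)) * (z + (r%:R + 1))) = 0.
  by rewrite -zE; ring.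
move/eqP; rewrite !mulf_eq0 !subr_eq0 !addr_eq0.
case/orP=> [/orP[]|/orP[]] /eqP->.
- by rewrite normr1 expr1n subrr mul0r addr0.
- by rewrite normrN1 sqrrN expr1n subrr mul0r addr0.
- rewrite -natrM -natrD normr_nat natrD natrM /c.
  by field; rewrite r20 r40.
- rewrite normrN natr1 normr_nat -natr1 /c.
  by field; rewrite r20 r40.
Qed.

(** * Equality of the energies *)

Theorem theorem7 (C : numClosedFieldType) (r : nat) (hr : (1 <= r)%N) :
  equienergetic C (join_family r) (complete_graph (3 * r + 4)).
Proof.
have r20 : r%:R + 2 != 0 :> C by rewrite -natrD pnatr_eq0 addn2.
have r40 : 3 * r%:R + 4 != 0 :> C by rewrite -natrM -natrD pnatr_eq0 addn4.
rewrite /equienergetic addnS energy_complete.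
rewrite (energy_join (@abs_join_family C r)) !natrD.
by field; rewrite r20 r40.
Qed.
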